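(* Let $\{x_1,\dots,x_n\}$ be a linearly independent system of vectors in $H$ and $M:=\operatorname{span}\{x_1,\dots,x_n\}$. If $x\in H$ and $x\notin M^{\perp}$, then $$d^2(x,M)<\frac{\|x\|^2\sum_{i=1}^n\|x_i\|^2-\sum_{i=1}^n|\langle x,x_i\rangle|^2}{\sum_{i=1}^n\|x_i\|^2},$$ or, equivalently, $$\Gamma(x_1,\dots,x_n,x)<\frac{\|x\|^2\sum_{i=1}^n\|x_i\|^2-\sum_{i=1}^n|\langle x,x_i\rangle|^2}{\sum_{i=1}^n\|x_i\|^2}\cdot\Gamma(x_1,\dots,x_n).$$
   Context: $(H;\langle\cdot,\cdot\rangle)$ is an inner product space over the real or complex number field $\mathbb{K}$, with norm $\|x\|=\langle x,x\rangle^{1/2}$. $M^{\perp}$ is the orthogonal complement of $M$ in $H$, and $d(x,M)=\inf_{y\in M}\|x-y\|$ is the distance from $x$ to $M$; $d^2(x,M)$ denotes its square. For vectors $y_1,\dots,y_m\in H$, $\Gamma(y_1,\dots,y_m)$ denotes the Gram determinant, i.e. the determinant of the $m\times m$ matrix whose $(i,j)$-entry is $\langle y_i,y_j\rangle$.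
   Formalization: The formal theorem assumes n ≥ 2: for n = 1 both strict inequalities are always equalities (e.g. x = x_1 gives 0 < 0), and for n = 0 no x lies outside the orthogonal complement of M. *)

(* Defs.v *)
From HB Require Import structures.
From mathcomp Require Import all_boot all_order all_algebra.
From mathcomp Require Import boolp classical_sets reals.
From mathcomp Require Import complex.

Set Implicit Arguments.
Unset Strict Implicit.
Unset Printing Implicit Defensive.

Import Order.TTheory GRing.Theory Num.Theory.
Local Open Scope classical_set_scope.
Local Open Scope ring_scope.

(* The field K of scalars is either R or R[i]; in both cases it carries the
   MathComp order, so that [a < b] in R[i] means that [b - a] is real and
   positive. *)
Variant scalar_kind := RealScalars | ComplexScalars.

Definition scalar_field (R : realType) (k : scalar_kind) : numFieldType :=
  match k with RealScalars => R | ComplexScalars => R[i] end.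

Definition sconj (R : realType) (k : scalar_kind) : scalar_field R k -> scalar_field R k :=
  match k with RealScalars => idfun | ComplexScalars => @Num.conj R[i] end.

Definition sre (R : realType) (k : scalar_kind) : scalar_field R k -> R :=
  match k with RealScalars => idfun | ComplexScalars => @complex.Re R end.

Definition of_real (R : realType) (k : scalar_kind) : R -> scalar_field R k :=
  match k with RealScalars => idfun | ComplexScalars => fun r => Complex r 0 end.
Arguments of_real {R} k.

(* The norm of the numFieldType R[i] takes its (real) values in R[i]. *)
Definition modulus (R : realType) (k : scalar_kind) (z : scalar_field R k) : R :=
  sre `|z|.

Section InnerProductSpace.
Variables (R : realType) (k : scalar_kind).
Local Notation K := (scalar_field R k).
(* [ip] is linear in its first argument and conjugate-linear in its second;
   no finiteness condition is put on the dimension of [H]. *)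
Variables (H : lmodType K) (ip : {dot H for @sconj R k}).

Definition hnorm (x : H) : R := Num.sqrt (sre (ip x x)).

Definition orthocomplement (M : set H) : set H :=
  [set x | forall y, M y -> ip x y = 0].

Definition dist_to (x : H) (M : set H) : R := inf [set hnorm (x - y) | y in M].

Definition linear_span n (xs : n.-tuple H) : set H :=
  [set y | exists c : 'I_n -> K, y = \sum_(i < n) c i *: tnth xs i].

Definition linearly_independent n (xs : n.-tuple H) : Prop :=
  forall c : 'I_n -> K,
    \sum_(i < n) c i *: tnth xs i = 0 -> forall i, c i = 0.

Definition gram n (ys : n.-tuple H) : K :=
  \det (\matrix_(i < n, j < n) ip (tnth ys i) (tnth ys j)).

End InnerProductSpace.

(* Main.v *)
(* Let p be the orthogonal projection of x on the span M and r = x - p. Then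
   <x, x_i> = <p, x_i>, so Cauchy-Schwarz gives
   |<x, x_i>|^2 <= |p|^2 |x_i|^2 = (|x|^2 - |r|^2) |x_i|^2.
   For n > 1 the nonzero vector p cannot be collinear with each of the
   independent x_i, so one of these inequalities is strict, and summing over i
   bounds |r|^2 strictly. Finally d(x, M) <= |r|, and the Gram determinant of
   x_1, ..., x_n, x is that of x_1, ..., x_n times |r|^2. *)
From HB Require Import structures.
Require Import Defs.
From mathcomp Require Import all_boot all_order all_algebra.
From mathcomp Require Import boolp classical_sets reals.
From mathcomp Require Import complex.

Import Order.TTheory GRing.Theory Num.Theory.
Local Open Scope classical_set_scope.
Local Open Scope ring_scope.

(** Appending a vector gives a Gram matrix of size [n.+1], while block matrices have size [n + 1];
    this passes between the two index types. *)
Lemma det_cast_ord {A : comPzRingType} {m n} (e : m = n)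
    (F : 'I_n -> 'I_n -> A) :
  \det (\matrix_(i, j) F i j)
  = \det (\matrix_(i, j) F (cast_ord e i) (cast_ord e j)).
Proof.
case: n / e F => F; congr (\det _).
by apply/matrixP=> i j; rewrite !mxE !cast_ord_id.
Qed.

(** * Scalars, treated uniformly in the real and the complex case *)

Section Scalars.
Context {R : realType} {k : scalar_kind}.
Local Notation K := (scalar_field R k).

Fact sconj_is_zmod_morphism : zmod_morphism (@sconj R k).
Proof. by case: k => //= x y; rewrite rmorphB. Qed.

Fact sconj_is_monoid_morphism : monoid_morphism (@sconj R k).
Proof. by case: k => //=; split=> [|x y]; rewrite ?rmorph1 ?rmorphM. Qed.

HB.instance Definition _ :=
  GRing.isZmodMorphism.Build K K (@sconj R k) sconj_is_zmod_morphism.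
HB.instance Definition _ :=
  GRing.isMonoidMorphism.Build K K (@sconj R k) sconj_is_monoid_morphism.

Lemma mul_sconj (z : K) : z * sconj z = `|z| ^+ 2.
Proof. by case: k z => /= z; rewrite ?normCK// real_normK ?num_real. Qed.

Fact of_real_is_zmod_morphism : zmod_morphism (of_real k : R -> K).
Proof. by case: k => //=; exact: (raddfB (real_complex R)). Qed.

Fact of_real_is_monoid_morphism : monoid_morphism (of_real k : R -> K).
Proof. by case: k => //=; split=> //; exact: (rmorphM (real_complex R)). Qed.

HB.instance Definition _ :=
  GRing.isZmodMorphism.Build R K (of_real k) of_real_is_zmod_morphism.
HB.instance Definition _ :=
  GRing.isMonoidMorphism.Build R K (of_real k) of_real_is_monoid_morphism.

Lemma ltr_of_real (a b : R) : (of_real k a < of_real k b :> K) = (a < b).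
Proof. by case: k => //=; exact: ltcR. Qed.

Lemma ler_of_real (a b : R) : (of_real k a <= of_real k b :> K) = (a <= b).
Proof. by case: k => //=; exact: lecR. Qed.

(** In the order of [R[i]], a nonnegative element is real, so its real part determines it. *)
Lemma sreK (z : K) : 0 <= z -> of_real k (sre z) = z.
Proof. by case: k z => //= z /ger0_real; exact: RRe_real. Qed.

Lemma of_real_modulus (z : K) : of_real k (modulus z) = `|z|.
Proof. by rewrite sreK. Qed.

End Scalars.

(** * Inner products and the Cauchy-Schwarz inequality *)

Section InnerProduct.
Context {R : realType} {k : scalar_kind}.
Local Notation K := (scalar_field R k).
Context {H : lmodType K} (ip : {dot H for @sconj R k}).

Lemma ip_conj (u v : H) : ip u v = sconj (ip v u).
Proof. by rewrite (hermC ip) mul1r. Qed.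

Lemma ipDl (u v w : H) : ip (u + v) w = ip u w + ip v w.
Proof. exact: linearDl. Qed.

Lemma ip_lincomb_eq0 {n} (xs : n.-tuple H) (c : 'I_n -> K) (u : H) :
  (forall i, ip u (tnth xs i) = 0) -> ip u (\sum_(i < n) c i *: tnth xs i) = 0.
Proof.
move=> uxs; rewrite linear_sumr big1// => i _.
by rewrite linearZr_LR /= uxs mulr0.
Qed.

Lemma ip_gt0 {u : H} : u != 0 -> 0 < ip u u.
Proof. exact: neq0_dnorm_gt0. Qed.

Lemma ip_ge0 (u : H) : 0 <= ip u u.
Proof. by have [->|/ip_gt0/ltW//] := eqVneq u 0; rewrite linear0r. Qed.

Lemma of_real_hnorm (u : H) : of_real k (hnorm ip u ^+ 2) = ip u u.
Proof.
rewrite sqr_sqrtr ?sreK ?ip_ge0// -(@ler_of_real _ k) rmorph0.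
by rewrite sreK ip_ge0.
Qed.

(** Here [w] is the component of [u] orthogonal to [v]. The identity gives the exact gap in
    Cauchy-Schwarz, which yields both the weak and the strict form. *)
Lemma ip_residual {u v : H} : v != 0 ->
  let w := u - (ip u v / ip v v) *: v in
  ip u u * ip v v - `|ip u v| ^+ 2 = ip w w * ip v v.
Proof.
move=> /ip_gt0/lt0r_neq0 v0 w.
have wv : ip w v = 0 by rewrite linearBl linearZl_LR /= divfK ?subrr.
have -> : ip w w = ip u u - ip u v / ip v v * ip v u.
  (* Expanding the second [w] first lets [wv] reduce [ip w w] to [ip w u]. *)
  by rewrite {2}/w linearBr linearZr_LR /= wv mulr0 subr0 linearBl linearZl_LR.
by rewrite mulrBl mulrAC divfK// [ip v u]ip_conj mul_sconj.
Qed.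

Lemma cauchy_schwarz (u v : H) : `|ip u v| ^+ 2 <= ip u u * ip v v.
Proof.
have [->|v0] := eqVneq v 0; first by rewrite !linear0r normr0 expr0n mulr0.
by rewrite -subr_ge0 ip_residual// mulr_ge0 ?ip_ge0.
Qed.

Lemma cauchy_schwarz_strict (u v : H) : v != 0 -> (forall a, u != a *: v) ->
  `|ip u v| ^+ 2 < ip u u * ip v v.
Proof.
move=> v0 uv; rewrite -subr_gt0 ip_residual// mulr_gt0 ?ip_gt0//.
by rewrite subr_eq0.
Qed.

(* Subtracting from the last row of the Gram matrix the combination of the
   others with coefficients [c] makes it block upper triangular. *)
Lemma gram_rcons {n} (xs : n.-tuple H) (c : 'I_n -> K) (r : H) :
  (forall i, ip r (tnth xs i) = 0) ->
  gram ip [tuple of rcons xs (\sum_(i < n) c i *: tnth xs i + r)]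
  = gram ip xs * ip r r.
Proof.
move=> rxs; set x := _ + r; rewrite /gram (det_cast_ord (addn1 n)).
pose G : 'M[K]_n := \matrix_(i, j) ip (tnth xs i) (tnth xs j).
pose b : 'M[K]_(n, 1) := \col_i ip (tnth xs i) x.
have tl i : tnth [tuple of rcons xs x] (cast_ord (addn1 n) (lshift 1 i))
    = tnth xs i.
  by rewrite !(tnth_nth 0) /= nth_rcons size_tuple ltn_ord.
have tr i : tnth [tuple of rcons xs x] (cast_ord (addn1 n) (rshift n i)) = x.
  by rewrite (tnth_nth 0) /= nth_rcons size_tuple ord1 addn0 ltnn eqxx.
have rx : ip r x = ip r r.
  by rewrite linearDr [X in X + _]ip_lincomb_eq0// add0r.
have xE v : ip x v = \sum_i c i * ip (tnth xs i) v + ip r v.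
  rewrite linearDl linear_sumlz; congr (_ + _); apply: eq_bigr => i _.
  by rewrite linearZl_LR.
set A := (X in \det X = _).
(* The left factor has determinant 1 and adds the combination of the first rows back to the last
   row, which on the right is that of [r]. *)
have -> : A = block_mx 1%:M 0 (\row_i c i) 1%:M
              *m block_mx G b 0 (ip r r)%:M.
  rewrite mulmx_block !mul1mx !mul0mx !addr0.
  rewrite -[LHS]submxK; congr block_mx; apply/matrixP=> i j; rewrite !mxE.
  - by rewrite !tl.
  - by rewrite tl tr.
  - rewrite tl tr xE rxs addr0.
    by apply: eq_bigr => l _; rewrite !mxE.
  - rewrite !tr xE rx !ord1 eqxx mulr1n; congr (_ + _).
    by apply: eq_bigr => l _; rewrite !mxE.
by rewrite det_mulmx det_lblock det_ublock !det1 !mul1r det_scalar1.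
Qed.

(** * Orthogonal projection and positivity of Gram determinants *)

Lemma orthogonal_projection {n} (xs : n.-tuple H) (x : H) :
  gram ip xs != 0 ->
  exists c : 'I_n -> K,
    forall j, ip (x - \sum_(i < n) c i *: tnth xs i) (tnth xs j) = 0.
Proof.
rewrite -unitfE => Gu; pose v : 'rV[K]_n := \row_j ip x (tnth xs j).
pose G : 'M[K]_n := \matrix_(i, j) ip (tnth xs i) (tnth xs j).
(* The coefficients solve the normal equations [c *m G = v]. *)
exists (fun i => (v *m invmx G) 0 i) => j.
rewrite linearBl linear_sumlz; apply/eqP; rewrite subr_eq0; apply/eqP.
have ipxE : ip x (tnth xs j) = (v *m invmx G *m G) 0 j by rewrite mulmxKV// mxE.
rewrite [LHS]ipxE [LHS]mxE.
by apply: eq_bigr => i _; rewrite linearZl_LR [G i j]mxE.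
Qed.


Lemma linearly_independent_rcons {n} (xs : n.-tuple H) (x : H) :
  linearly_independent [tuple of rcons xs x] ->
  linearly_independent xs /\
  forall c : 'I_n -> K, x != \sum_(i < n) c i *: tnth xs i.
Proof.
move=> indep.
have indepE (c : 'I_n.+1 -> K) :
    \sum_(i < n) c (widen_ord (leqnSn n) i) *: tnth xs i + c ord_max *: x = 0 ->
    forall i, c i = 0.
  move=> c0; apply: indep; rewrite big_ord_recr /= -[RHS]c0.
  congr (_ + _ *: _); last first.
    by rewrite (tnth_nth 0) /= nth_rcons size_tuple ltnn eqxx.
  apply: eq_bigr => i _; congr (_ *: _).
  by rewrite !(tnth_nth 0) /= nth_rcons size_tuple ltn_ord.
(* [insub] fails exactly at the last index [n], where the default [a] is taken. *)
have extE (c : 'I_n -> K) a : exists F : 'I_n.+1 -> K,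
    (forall i, F (widen_ord (leqnSn n) i) = c i) /\ F ord_max = a.
  exists (fun i => oapp c a (insub (val i))).
  by split=> [i|] /=; rewrite ?valK// insubF ?ltnn.
split=> [c c0 i|c].
  have [F [cE aE]] := extE c 0; rewrite -cE; apply: indepE.
  rewrite aE scale0r addr0 -[RHS]c0.
  by apply: eq_bigr => j _; rewrite cE.
apply/eqP => xE; have [F [cE aE]] := extE c (- 1).
suff /eqP : (- 1 : K) = 0 by rewrite oppr_eq0 oner_eq0.
rewrite -aE; apply: indepE; rewrite aE scaleN1r xE.
by apply/eqP; rewrite subr_eq0; apply/eqP/eq_bigr => j _; rewrite cE.
Qed.

(** By induction: splitting the last vector [y] into its projection on the others and a residual
    multiplies the Gram determinant by the squared norm of the residual, which is nonzero since [y]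
    is outside their span. *)
Lemma gram_gt0 {n} (xs : n.-tuple H) : linearly_independent xs -> 0 < gram ip xs.
Proof.
elim: n xs => [|n IHn] xs; first by rewrite /gram det_mx00 ltr01.
have [ys [y ->]] : exists (ys : n.-tuple H) y, xs = [tuple of rcons ys y].
  case/tupleP: xs => y ys; exists [tuple of belast y ys], (last y ys).
  by apply: val_inj; rewrite /= -lastI.
move=> /linearly_independent_rcons[/IHn ys0 yP].
have [c cP] := orthogonal_projection ys y (lt0r_neq0 ys0).
rewrite -[y](subrK (\sum_(i < n) c i *: tnth ys i)) addrC gram_rcons//.
by rewrite mulr_gt0// ip_gt0// subr_eq0.
Qed.

Lemma sum_cauchy_schwarz_lt {n} (xs : n.-tuple H) (c : 'I_n -> K)
    (p := \sum_(i < n) c i *: tnth xs i) :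
  (1 < n)%N -> linearly_independent xs -> p != 0 ->
  \sum_(i < n) `|ip p (tnth xs i)| ^+ 2
  < ip p p * \sum_(i < n) ip (tnth xs i) (tnth xs i).
Proof.
move=> n1 indep p0.
have [j cj0] : exists j, c j != 0.
  apply/existsP; apply: contra_neqT p0 => /existsPn c0.
  by rewrite /p big1// => i _; have /negPn/eqP-> := c0 i; rewrite scale0r.
(* The index [i] is 1 if [j] is 0, and 0 otherwise. *)
have [i ij] : exists i : 'I_n, i != j.
  have [j0|j0] := eqVneq (val j) 0%N.
    by exists (Ordinal n1); rewrite -val_eqE /= j0.
  by exists (Ordinal (ltnW n1)); rewrite -val_eqE /= eq_sym.
have deltaE a : \sum_(l < n) ((l == i)%:R * a) *: tnth xs l = a *: tnth xs i.
  rewrite (bigD1 i)//= eqxx mul1r big1 ?addr0// => l /negPf->.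
  by rewrite mul0r scale0r.
have xi0 : tnth xs i != 0.
  apply/eqP => xi0; have /(_ _ i)/eqP := indep (fun l => (l == i)%:R * 1).
  by rewrite deltaE xi0 scaler0 eqxx mul1r oner_eq0 => /(_ erefl).
(* If [p] were [a *: tnth xs i], subtracting would give a vanishing combination whose coefficient at
   [j] is still [c j], against independence. *)
have pxi a : p != a *: tnth xs i.
  apply/eqP => pa; move/eqP: cj0; apply.
  have /(_ _ j) := indep (fun l => c l - (l == i)%:R * a).
  rewrite eq_sym (negPf ij) mul0r subr0; apply.
  under eq_bigr do rewrite scalerBl.
  by rewrite sumrB deltaE -pa subrr.
rewrite mulr_sumr (bigD1 i)//= [ltRHS](bigD1 i)//= ltr_leD//.
  exact: cauchy_schwarz_strict.
by apply: ler_sum => l _; exact: cauchy_schwarz.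
Qed.

Lemma dist_to_le (x y : H) (M : set H) :
  M y -> dist_to ip x M <= hnorm ip (x - y).
Proof.
move=> My; apply: ge_inf; last by exists y.
by exists 0 => _ [z _ <-]; exact: sqrtr_ge0.
Qed.

(** For empty [M] this rests on the convention that [inf set0] is 0. *)
Lemma dist_to_ge0 (x : H) (M : set H) : 0 <= dist_to ip x M.
Proof.
rewrite /dist_to; set A := image _ _.
have [->|/set0P A0] := eqVneq A set0; first by rewrite inf0.
by apply: lb_le_inf => // _ [z _ <-]; exact: sqrtr_ge0.
Qed.

End InnerProduct.

Theorem theorem1 (R : realType) (k : scalar_kind) (H : lmodType (scalar_field R k))
    (ip : {dot H for @sconj R k}) (n : nat) (xs : n.-tuple H) (x : H) :
  (1 < n)%N ->
  linearly_independent xs ->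
  ~ orthocomplement ip (linear_span xs) x ->
  let s := \sum_(i < n) hnorm ip (tnth xs i) ^+ 2 in
  let bound := (hnorm ip x ^+ 2 * s
                - \sum_(i < n) modulus (ip x (tnth xs i)) ^+ 2) / s in
  dist_to ip x (linear_span xs) ^+ 2 < bound /\
  gram ip [tuple of rcons xs x] < of_real k bound * gram ip xs.
Proof.
move=> n1 indep xM s bound; have G0 := gram_gt0 ip xs indep.
have [c] := orthogonal_projection ip xs x (lt0r_neq0 G0).
set p := \sum_(i < n) _; set r := x - p => rxs.
have xE : x = p + r by rewrite addrC subrK.
have ipx i : ip x (tnth xs i) = ip p (tnth xs i).
  by rewrite xE ipDl rxs addr0.
(* If [p] were 0, [x] would be orthogonal to every [tnth xs i], hence to their span. *)
have p0 : p != 0.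
  apply: contra_notN xM => /eqP p0 _ [a ->].
  by apply: ip_lincomb_eq0 => i; rewrite ipx p0 linear0l.
have pr : ip p r = 0 by rewrite ip_conj ip_lincomb_eq0// rmorph0.
have ipxx : ip x x = ip p p + ip r r by rewrite xE; exact: hnormDd.
have lt_sum := sum_cauchy_schwarz_lt ip xs c n1 indep p0.
have sE : of_real k s = \sum_(i < n) ip (tnth xs i) (tnth xs i).
  by rewrite rmorph_sum; apply: eq_bigr => i _; rewrite /= of_real_hnorm.
(* Positivity is read off [lt_sum]: a sum of squares lies strictly below [ip p p] times [s], and
   [ip p p] is positive. *)
have s0 : 0 < s.
  rewrite -(@ltr_of_real _ k) rmorph0 -(pmulr_rgt0 _ (ip_gt0 ip p0)) sE.
  apply: le_lt_trans lt_sum.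
  by rewrite sumr_ge0// => i _; rewrite exprn_ge0.
(* Clearing the denominator and using Pythagoras to replace [ip x x - ip r r] by [ip p p] turns the
   claim into [lt_sum]. *)
have lt_bound : hnorm ip r ^+ 2 < bound.
  rewrite ltr_pdivlMr// ltrBrDr addrC -ltrBrDr -mulrBl -(@ltr_of_real _ k).
  rewrite rmorphM rmorphB rmorph_sum /= sE !of_real_hnorm ipxx addrK.
  under eq_bigr do rewrite rmorphXn /= of_real_modulus ipx.
  exact: lt_sum.
split.
  apply: le_lt_trans lt_bound.
  rewrite ler_pXn2r ?nnegrE ?dist_to_ge0 ?sqrtr_ge0//.
  by apply: dist_to_le; exists c.
(* Cancelling the positive factor [gram ip xs] leaves [lt_bound], embedded in the scalar field. *)
have := gram_rcons ip xs c r rxs; rewrite -/p -xE => ->.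
rewrite mulrC ltr_pM2r//.
by rewrite -of_real_hnorm ltr_of_real.
Qed.
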